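(* The Hilbert extender graph $H_P$ of an interval order $P$ is a perfect graph.
   Context: A finite (strictly) partially ordered set $P=(X,\prec)$, $X=\{1,\dots,n\}$, is an interval order if there are compact real intervals $[\ell_x,r_x]$, $x\in X$, with $\ell_x\le r_x$, such that $x\prec y$ if and only if $r_x<\ell_y$. Interval representations are moreover required to satisfy $r_x+1\le \ell_y$ for all $x\prec y$. A natural representation is one in which all endpoints are non-negative integers. The magnitude $m$ of $P$ is the number of distinct down-sets $D(z)=\{x: x\prec z\}$, $z\in X$. The canonical representation of $P$ is the (unique) natural representation whose set of interval endpoints is $\{0,1,\dots,m-1\}$. The length polyhedron $Q_P\subset\mathbb{R}^n$ is the set of all vectors $(r_x-\ell_x)_{x\in X}$ over all interval representations of $P$ with real endpoints (satisfying $r_x+1\le\ell_y$ for all $x\prec y$). Let $\boldsymbol{\rho^*}$ be the vector of interval lengths of the canonical representation. Then $Q_P=\boldsymbol{\rho^*}+Q_P^*$, where $Q_P^*=\{v-\boldsymbol{\rho^*}: v\in Q_P\}$ is a pointed rational cone. Let $[\ell_x,r_x]$, $x\in X$, now denote the intervals of the canonical representation. For $1\le i\le m-1$ the $i$th gap set is $\mathcal{G}_i=\{x\in X:\ell_x\le i-1\text{ and } i\le r_x\}$, and $\mathcal{G}_0=\mathcal{G}_m=\varnothing$. For $0\le i\le m$ the left- and right-borderline sets are $\mathcal{L}_i=\{x\in X: r_x=i-1\}$ and $\mathcal{R}_i=\{x\in X:\ell_x=i\}$. A non-empty set $S\subseteq X$ is a fundamental extender if there are an index $0\le i\le m$ and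 a set $Z$ with $Z\subseteq\mathcal{L}_i$ or $Z\subseteq\mathcal{R}_i$ such that $S=\mathcal{G}_i\cup Z$. $\mathcal{E}_P$ is the collection of all fundamental extenders. An integral Hilbert basis of a polyhedral cone is a finite set of integral vectors of the cone such that each integral vector in the cone is a non-negative integral linear combination of vectors from this set. A pointed rational cone has a unique (inclusion-)minimal integral Hilbert basis; for $Q_P^*$ it is contained in the set of characteristic vectors of the sets in $\mathcal{E}_P$. A set $S\subseteq X$ is a Hilbert set if $S\in\mathcal{E}_P$ and its characteristic vector belongs to this unique minimal integral Hilbert basis. The Hilbert extender graph $H_P$ is the (vertex-weighted) graph with one vertex $v$ for each Hilbert set $S_v$, distinct vertices $u,v$ being adjacent if and only if $S_u\cap S_v\ne\varnothing$; vertex $v$ has weight $|S_v|$ (weights play no role for perfection). A graph is perfect if for every induced subgraph the chromatic number equals the size of a maximum clique. *)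

(* Defs.v *)
From HB Require Import structures.
From mathcomp Require Import all_boot all_order all_algebra.
From mathcomp Require Import finmap.
From mathcomp Require Import boolp classical_sets functions cardinality reals.
From mathcomp Require Import zify.

Set Implicit Arguments.
Unset Strict Implicit.
Unset Printing Implicit Defensive.

Import Order.TTheory GRing.Theory Num.Theory.

Local Open Scope ring_scope.

Definition strict_order (X : Type) (P : rel X) : Prop :=
  irreflexive P /\ transitive P.

Definition interval_model (R : realType) (X : Type) (P : rel X)
    (l r : X -> R) : Prop :=
  (forall x, l x <= r x) /\ (forall x y, P x y <-> r x < l y).

Definition interval_order (R : realType) (X : Type) (P : rel X) : Prop :=
  strict_order P /\ exists l r : X -> R, interval_model P l r.

(* Representations, unlike mere models, separate comparable intervals by at
   least 1. *)
Definition interval_representation (R : realType) (X : Type) (P : rel X)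
    (l r : X -> R) : Prop :=
  interval_model P l r /\ (forall x y, P x y -> r x + 1 <= l y).

Definition natural_representation (R : realType) (X : Type) (P : rel X)
    (l r : X -> nat) : Prop :=
  interval_representation P (fun x => (l x)%:R : R) (fun x => (r x)%:R : R).

Definition downset (X : finType) (P : rel X) (z : X) : {set X} :=
  [set x | P x z].

Definition magnitude (X : finType) (P : rel X) : nat :=
  #|[set downset P z | z in [set: X]]|.

Definition is_canonical (R : realType) (X : finType) (P : rel X)
    (lr : (X -> nat) * (X -> nat)) : Prop :=
  natural_representation R P lr.1 lr.2 /\
  (range lr.1 `|` range lr.2 = [set k | (k < magnitude P)%N])%classic.

(* The default value of [xget] is irrelevant for interval orders, by
   [canonicalP] below. *)
Definition canonical (R : realType) (X : finType) (P : rel X) :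
    (X -> nat) * (X -> nat) :=
  xget ((fun=> 0%N), (fun=> 0%N)) (is_canonical R P).

Definition canon_l (R : realType) (X : finType) (P : rel X) : X -> nat :=
  (canonical R P).1.

Definition canon_r (R : realType) (X : finType) (P : rel X) : X -> nat :=
  (canonical R P).2.

Lemma canonical_exists (R : realType) (X : finType) (P : rel X) :
  interval_order R P -> exists lr, is_canonical R P lr.
Proof.
move=> [[irr _] [l [r [_ mod]]]].
pose D := downset P.
pose F := [set D z | z in [set: X]]%SET.
have DF z : D z \in F by apply: imset_f.
have chain (A B : {set X}) : A \in F -> B \in F -> (A \subset B) || (B \subset A).
  move=> /imsetP[a _ ->] /imsetP[b _ ->].
  have mono u v : l u <= l v -> D u \subset D v.
    move=> uv; apply/fintype.subsetP => x; rewrite !inE => /mod xu.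
    by apply/mod; apply: lt_le_trans uv.
  by case: (leP (l a) (l b)) => [/mono -> //|/ltW/mono ->]; rewrite orbT.
pose below (A : {set X}) := [set B in F | B \proper A]%SET.
pose avoid x := [set B in F | x \notin B]%SET.
pose lc x := #|below (D x)|.
pose rc x := #|avoid x|.-1.
have sub_avoid x y : ~~ P x y -> D y |: below (D y) \subset avoid x.
  move=> nxy; apply/fintype.subsetP => B; rewrite !inE => /orP[/eqP ->|/andP[BF]].
    by rewrite DF inE.
  rewrite BF => /properP[/fintype.subsetP BD _] /=.
  by apply: contra nxy => /BD; rewrite inE.
have lt_avoid x y : ~~ P x y -> (lc y < #|avoid x|)%N.
  move=> /sub_avoid /subset_leq_card; rewrite cardsU1 !inE fintype.properxx andbF /=.
  by rewrite add1n.
have avoid_gt0 x : (0 < #|avoid x|)%N.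
  by apply: leq_ltn_trans (lt_avoid x x _) => //; rewrite irr.
have le_lr x : (lc x <= rc x)%N.
  by have := lt_avoid x x; rewrite irr => /(_ isT); rewrite /rc; lia.
have PE x y : P x y = (rc x < lc y)%N.
  apply/idP/idP => [xy|]; last first.
    by apply: contraTT => /lt_avoid; rewrite /rc; have := avoid_gt0 x; lia.
  have : (#|avoid x| <= lc y)%N.
    apply/subset_leq_card/fintype.subsetP => B; rewrite !inE => /andP[BF xB].
    rewrite BF /= fintype.properE; apply/andP.
    have nDB : ~~ (D y \subset B).
      by apply: contra xB => /fintype.subsetP; apply; rewrite inE.
    by split=> //; have := chain _ _ BF (DF y); rewrite (negPf nDB) orbF.
  by rewrite /rc; have := avoid_gt0 x; lia.
have below_lt (A : {set X}) : A \in F -> (#|below A| < #|F|)%N.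
  move=> AF; apply/proper_card/properP; split.
    by apply/fintype.subsetP => B; rewrite inE => /andP[].
  by exists A; rewrite // inE fintype.properxx andbF.
have below_mono (A B : {set X}) : A \in F -> A \proper B -> (#|below A| < #|below B|)%N.
  move=> AF AB; apply/proper_card/properP; split; last first.
    by exists A; rewrite !inE ?AF ?fintype.properxx.
  apply/fintype.subsetP => C; rewrite !inE => /andP[-> /=].
  by move=> CA; apply: fintype.proper_trans AB.
have below_inj : {in F &, injective (fun A : {set X} => #|below A|)}.
  move=> A B AF BF /= eAB; apply/eqP; rewrite finset.eqEsubset.
  have [AB|nAB] := boolP (A \subset B); have [BA|nBA] := boolP (B \subset A) => //.
  - have := @below_mono A B AF; rewrite fintype.properE AB nBA => /(_ isT).
    by rewrite eAB ltnn.
  - have := @below_mono B A BF; rewrite fintype.properE BA nAB => /(_ isT).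
    by rewrite eAB ltnn.
  - by have := chain _ _ AF BF; rewrite (negPf nAB) (negPf nBA).
have lc_surj k : (k < #|F|)%N -> exists x, lc x = k.
  move=> kF; pose s := [seq #|below A| | A <- enum F].
  have us : uniq s.
    rewrite map_inj_in_uniq ?enum_uniq // => A B.
    by rewrite !mem_enum; apply: below_inj.
  have ss : {subset s <= iota 0 #|F|}.
    move=> j /mapP[A]; rewrite mem_enum => AF ->.
    by rewrite mem_iota add0n below_lt.
  have sz : (size (iota 0 #|F|) <= size s)%N by rewrite size_iota size_map -cardE.
  have [_ eq_s] := uniq_min_size us ss sz.
  have : k \in s by rewrite eq_s mem_iota.
  by case/mapP => A; rewrite mem_enum => /imsetP[x _ ->] ->; exists x.
have rc_lt x : (rc x < #|F|)%N.
  have : (#|avoid x| <= #|F|)%N.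
    by apply/subset_leq_card/fintype.subsetP => B; rewrite inE => /andP[].
  by rewrite /rc; have := avoid_gt0 x; lia.
exists (lc, rc); split.
  split=> [|x y]; last by rewrite PE /= natr1 ler_nat.
  by split=> [x|x y] /=; rewrite ?ler_nat ?ltr_nat ?PE.
apply/seteqP; split=> k /=.
  by case=> -[x _ <-]; [apply: leq_ltn_trans (rc_lt x)|].
by move=> /lc_surj [x <-]; left; exists x.
Qed.

Lemma canonicalP (R : realType) (X : finType) (P : rel X) :
  interval_order R P -> is_canonical R P (canonical R P).
Proof. by move=> /canonical_exists; apply: xgetPex. Qed.

Definition length_polyhedron (R : realType) (n : nat) (P : rel 'I_n) :
    set 'rV[R]_n :=
  [set v | exists l r : 'I_n -> R,
     interval_representation P l r /\ v = \row_x (r x - l x)]%classic.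

Definition canon_lengths (R : realType) (n : nat) (P : rel 'I_n) : 'rV[R]_n :=
  \row_x ((canon_r R P x)%:R - (canon_l R P x)%:R).

Definition length_cone (R : realType) (n : nat) (P : rel 'I_n) :
    set 'rV[R]_n :=
  [set v - canon_lengths R P | v in length_polyhedron P]%classic.

Definition integral_vector (R : realType) (n : nat) (v : 'rV[R]_n) : Prop :=
  forall x, v 0 x \is a Num.int.

Definition hilbert_basis (R : realType) (n : nat) (C : set 'rV[R]_n)
    (B : {fset 'rV[R]_n}) : Prop :=
  (forall b, b \in B -> integral_vector b /\ C b) /\
  (forall v, C v -> integral_vector v ->
     exists c : 'rV[R]_n -> nat, v = \sum_(b <- B) b *+ c b).

Definition minimal_hilbert_basis (R : realType) (n : nat) (C : set 'rV[R]_n)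
    (B : {fset 'rV[R]_n}) : Prop :=
  hilbert_basis C B /\
  (forall B', hilbert_basis C B' -> (B' `<=` B)%fset -> B' = B).

Definition gap_set (R : realType) (X : finType) (P : rel X) (i : nat) :
    {set X} :=
  [set x | [&& 0 < i < magnitude P, canon_l R P x <= i.-1 & i <= canon_r R P x]]%N.

(* [r = i - 1] is written [r + 1 = i]: subtraction on [nat] is truncated, and
   the left-borderline set of index 0 is empty. *)
Definition left_borderline (R : realType) (X : finType) (P : rel X) (i : nat) :
    {set X} :=
  [set x | (canon_r R P x).+1 == i].

Definition right_borderline (R : realType) (X : finType) (P : rel X)
    (i : nat) : {set X} :=
  [set x | canon_l R P x == i].

Definition fundamental_extender (R : realType) (X : finType) (P : rel X)
    (S : {set X}) : Prop :=
  S != finset.set0 /\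
  exists (i : nat) (Z : {set X}),
    [/\ (i <= magnitude P)%N,
        Z \subset left_borderline R P i \/ Z \subset right_borderline R P i
      & S = gap_set R P i :|: Z].

Definition char_vector (R : realType) (n : nat) (S : {set 'I_n}) : 'rV[R]_n :=
  \row_x (x \in S)%:R.

Definition hilbert_set (R : realType) (n : nat) (P : rel 'I_n)
    (S : {set 'I_n}) : Prop :=
  fundamental_extender R P S /\
  exists B, minimal_hilbert_basis (length_cone P) B /\ char_vector R S \in B.

Record sgraph := SGraph {
  vertex :> finType;
  edge : rel vertex;
  edge_sym : symmetric edge;
  edge_irrefl : irreflexive edge
}.

Record weighted_graph := WeightedGraph {
  underlying :> sgraph;
  weight : underlying -> nat
}.

Definition clique (G : sgraph) (K : {set G}) : bool :=
  [forall x in K, forall y in K, (x != y) ==> edge x y].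

Definition clique_number (G : sgraph) : nat :=
  \max_(K : {set G} | clique K) #|K|.

Definition colorable (G : sgraph) (k : nat) : bool :=
  [exists f : {ffun G -> 'I_k}, [forall x, forall y, edge x y ==> (f x != f y)]].

Lemma colorable_exists (G : sgraph) : exists k, colorable G k.
Proof.
exists #|G|; apply/existsP; exists [ffun x => enum_rank x].
apply/forallP => x; apply/forallP => y; apply/implyP => xy; rewrite !ffunE.
by apply: contraTneq xy => /enum_rank_inj ->; rewrite edge_irrefl.
Qed.

Definition chromatic_number (G : sgraph) : nat := ex_minn (colorable_exists G).

Definition induced (G : sgraph) (W : {set G}) : sgraph :=
  @SGraph {x : G | x \in W} (fun u v => edge (val u) (val v))
    (fun u v => edge_sym (val u) (val v)) (fun u => edge_irrefl (val u)).

Definition perfect (G : sgraph) : Prop :=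
  forall W : {set G},
    chromatic_number (induced W) = clique_number (induced W).

Definition hilbert_vertex (R : realType) (n : nat) (P : rel 'I_n) : finType :=
  {S : {set 'I_n} | `[< hilbert_set R P S >]}.

Definition hilbert_edge (R : realType) (n : nat) (P : rel 'I_n) :
    rel (hilbert_vertex R P) :=
  fun u v => (u != v) && (val u :&: val v != finset.set0).

Lemma hilbert_edge_sym (R : realType) (n : nat) (P : rel 'I_n) :
  symmetric (@hilbert_edge R n P).
Proof. by move=> u v; rewrite /hilbert_edge eq_sym finset.setIC. Qed.

Lemma hilbert_edge_irrefl (R : realType) (n : nat) (P : rel 'I_n) :
  irreflexive (@hilbert_edge R n P).
Proof. by move=> u; rewrite /hilbert_edge eqxx. Qed.

Definition hilbert_extender_graph (R : realType) (n : nat) (P : rel 'I_n) :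
    weighted_graph :=
  @WeightedGraph
    (SGraph (@hilbert_edge_sym R n P) (@hilbert_edge_irrefl R n P))
    (fun v => #|val v|).

(* Main.v *)
Require Import Defs.
From mathcomp Require Import all_boot reals.
From mathcomp Require Import zify.
From mathcomp Require all_order all_algebra finmap boolp classical_sets lra.

(** The Hilbert extender graph is the incomparability graph of a strict order
    on its vertices, and incomparability graphs are perfect: chains are
    independent sets, antichains are cliques, and Dilworth's theorem
    ([dilworth]) covers the order by as many chains as there are elements in
    some antichain ([cocomparability_perfect]).

    To define the order, give every Hilbert set [S] an index [i] such that [S]
    is the [i]th gap set together with part of one of the two borderline sets
    of index [i].  The set [S] precedes [T] when they are disjoint and the key
    of [S] is smaller, where keys compare lexicographically the index, then the
    sum of [l x + r x] over the set, then an arbitrary rank.  Only transitivity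
    needs an argument.  For three increasing indices [i < j < k], an interval
    that belongs to both the first and the last set spans the [j]th gap, so it
    lies in the middle set too.  Equal indices rely on the Hilbert sets being
    indecomposable: a Hilbert set is not the disjoint union of two fundamental
    extenders ([hilbert_set_indecomposable]).  Hence two disjoint Hilbert sets
    of the same index are singletons and their gap set is empty
    ([disjoint_same_index]); for such singletons the sum [l x + r x] puts the
    intervals ending just before the gap, by increasing left endpoint, ahead of
    those starting just after it, by increasing right endpoint, which is what
    transitivity requires.

    Indecomposability follows from two facts on the length cone: it contains
    the characteristic vectors of the fundamental extenders
    ([extender_in_cone]), and its vectors are non-negative because canonical
    lengths are minimal ([canon_lengths_le]).  If the characteristic vector of
    [S] is the sum of those of two disjoint extenders, these are generated by
    the other elements of the Hilbert basis, so the basis is not minimal. *)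

Set Implicit Arguments.
Unset Strict Implicit.
Unset Printing Implicit Defensive.

(** * Dilworth's theorem *)

Definition antichain (T : finType) (lt : rel T) (A : {set T}) : Prop :=
  {in A &, forall x y, ~~ lt x y}.

(** [f] colors [W] with the colors [0], ..., [k - 1] and its color classes are
    chains: a cover of [W] by [k] chains. *)
Definition chain_coloring (T : finType) (lt : rel T) (W : {set T}) (k : nat)
    (f : T -> nat) : Prop :=
  {in W, forall x, f x < k} /\
  {in W &, forall x y, f x = f y -> [|| x == y, lt x y | lt y x]}.

Lemma chain_coloring_inj (T : finType) (lt : rel T) (W A : {set T}) k f :
  chain_coloring lt W k f -> A \subset W -> antichain lt A ->
  {in A &, injective f}.
Proof.
move=> [_ fc] /subsetP AW Aa x y xA yA fxy.
have := fc _ _ (AW _ xA) (AW _ yA) fxy.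
by rewrite (negPf (Aa _ _ xA yA)) (negPf (Aa _ _ yA xA)) !orbF => /eqP.
Qed.

Lemma chain_coloring_image (T : finType) (lt : rel T) (W A : {set T}) k f :
  chain_coloring lt W k f -> A \subset W -> antichain lt A ->
  uniq [seq f x | x <- enum A] /\ {subset [seq f x | x <- enum A] <= iota 0 k}.
Proof.
move=> fW AW Aa; split.
  rewrite map_inj_in_uniq ?enum_uniq // => x y; rewrite !mem_enum.
  exact: (chain_coloring_inj fW AW Aa).
move=> c /mapP[x]; rewrite mem_enum mem_iota => xA ->.
by rewrite fW.1 // (subsetP AW).
Qed.

Lemma antichain_leq (T : finType) (lt : rel T) (W A : {set T}) k f :
  chain_coloring lt W k f -> A \subset W -> antichain lt A -> #|A| <= k.
Proof.
move=> fW AW Aa; have [u s] := chain_coloring_image fW AW Aa.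
by have := uniq_leq_size u s; rewrite size_map size_iota -cardE.
Qed.

(** An antichain with as many elements as there are chains meets every
    chain. *)
Lemma antichain_hits (T : finType) (lt : rel T) (W A : {set T}) k f c :
  chain_coloring lt W k f -> A \subset W -> antichain lt A -> #|A| = k ->
  c < k -> exists2 x, x \in A & f x = c.
Proof.
move=> fW AW Aa kA ck; have [u s] := chain_coloring_image fW AW Aa.
have sz : size (iota 0 k) <= size [seq f x | x <- enum A].
  by rewrite size_map size_iota -cardE kA.
have [_ e] := uniq_min_size u s sz.
have : c \in [seq f x | x <- enum A] by rewrite e mem_iota.
by case/mapP => x; rewrite mem_enum => xA ->; exists x.
Qed.

(** Dilworth's theorem: some antichain of [W] has as many elements as there are
    chains in some cover of [W].  This is Galvin's proof, which removes a maximal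
    element [a] and argues by induction on the number of elements. *)
Theorem dilworth (T : finType) (lt : rel T) (W : {set T}) :
  irreflexive lt -> transitive lt ->
  exists (A : {set T}) (f : T -> nat),
    [/\ A \subset W, antichain lt A & chain_coloring lt W #|A| f].
Proof.
move=> irr tr.
(* [h] is strictly increasing, so elements maximizing it are maximal. *)
pose h x := #|[set y | lt y x]|.
have h_mono x y : lt x y -> h x < h y.
  move=> xy; apply/proper_card/properP; split.
    by apply/subsetP => z; rewrite !inE => /tr; apply.
  by exists x; rewrite !inE // irr.
have [N] := ubnP #|W|; elim: N W => // N IH W WN.
have [->|[a0 a0W]] := set_0Vmem W.
  exists set0, (fun=> 0); split; rewrite ?sub0set //.
    by move=> x; rewrite inE.
  by split=> x; rewrite inE.
pose a := [arg max_(x > a0 in W) h x].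
have [aW amax] : a \in W /\ {in W, forall x, ~~ lt a x}.
  rewrite /a; case: arg_maxnP => // b bW bmax; split=> // x xW.
  by apply: contraTN (bmax x xW) => /h_mono; rewrite -ltnNge.
have W'N : #|W :\ a| < N by move: WN; rewrite (cardsD1 a W) aW; lia.
have [A0 [f [A0W A0a fW]]] := IH _ W'N.
set k := #|A0| in fW.
have W'W : W :\ a \subset W by apply: subD1set.
(* The good elements are those of the largest antichains of [W :\ a]. *)
pose good x := [exists B : {set T}, [&& B \subset W :\ a, #|B| == k, x \in B &
  [forall x in B, forall y in B, ~~ lt x y]]].
have goodP x : reflect (exists B : {set T}, [/\ B \subset W :\ a, #|B| = k, x \in B &
    antichain lt B]) (good x).
  apply: (iffP existsP) => [[B /and4P[BW /eqP kB xB /forall_inP Ba]]|[B [BW kB xB Ba]]].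
    exists B; split=> // y z yB zB; have /forall_inP := Ba y yB; exact.
  exists B; rewrite BW kB eqxx xB /=.
  by apply/forall_inP => y yB; apply/forall_inP => z; apply: Ba.
have goodW x : good x -> x \in W :\ a.
  by case/goodP => B [/subsetP BW _ xB _]; apply: BW.
(* For [c < k], [x0 c] is the top good element of the chain of color [c]. *)
have /boolp.choice[x0 x0P] : forall c, exists x, c < k ->
    [/\ good x, f x = c & forall y, good y -> f y = c -> (y == x) || lt y x].
  move=> c.
  have [ck|] := boolP (c < k); last by exists a.
  have [y0 y0A fy0] := antichain_hits fW A0W A0a (erefl _) ck.
  have gy0 : good y0 && (f y0 == c).
    by rewrite fy0 eqxx andbT; apply/goodP; exists A0.
  case: (@arg_maxnP _ y0 (fun y => good y && (f y == c)) h gy0) => x /andP[gx /eqP fx] xmax.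
  exists x => _; split=> // y gy fy.
  have hyx : h y <= h x by apply: xmax; rewrite gy fy eqxx.
  have := fW.2 y x (goodW _ gy) (goodW _ gx); rewrite fx fy => /(_ erefl).
  case/or3P=> [->|->|/h_mono]; rewrite ?orbT //; lia.
pose A := [set x0 (val c) | c : 'I_k].
have x0_inj : injective (fun c : 'I_k => x0 (val c)).
  move=> c d /= e; apply: val_inj => /=.
  have [_ <- _] := x0P c (ltn_ord c); have [_ <- _] := x0P d (ltn_ord d).
  by rewrite e.
have kA : #|A| = k by rewrite card_imset // card_ord.
have AW : A \subset W :\ a.
  by apply/subsetP => _ /imsetP[c _ ->]; have [/goodW] := x0P c (ltn_ord c).
have Aa : antichain lt A.
  move=> _ _ /imsetP[c _ ->] /imsetP[d _ ->]; apply/negP => xcd.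
  have [_ _ cmax] := x0P c (ltn_ord c).
  have [/goodP[B [BW kB dB Ba]] _ _] := x0P d (ltn_ord d).
  have [y yB fy] := antichain_hits fW BW Ba kB (ltn_ord c).
  have gy : good y by apply/goodP; exists B.
  have /orP[/eqP e|yc] := cmax _ gy fy.
    by have := Ba _ _ yB dB; rewrite e xcd.
  by have := Ba _ _ yB dB; rewrite (tr _ _ _ yc xcd).
have [/existsP[c ca]|/existsPn nca] := boolP [exists c : 'I_k, lt (x0 (val c)) a].
  have [gc fc cmax] := x0P c (ltn_ord c).
  set xc := x0 (val c) in ca gc fc cmax.
  (* [K] is a chain, and it meets every antichain of [k] elements of [W :\ a],
     so that [k - 1] chains suffice outside [K]. *)
  pose K := a |: [set z in W :\ a | (f z == c) && ((z == xc) || lt z xc)].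
  have WKW : W :\: K \subset W :\ a.
    by apply/subsetP => z; rewrite !inE => /andP[/norP[-> _] ->].
  have WKN : #|W :\: K| < N by apply: leq_ltn_trans (subset_leq_card WKW) W'N.
  have [A1 [g [A1W A1a gW]]] := IH _ WKN.
  have A1W' := fintype.subset_trans A1W WKW.
  have A1k : #|A1| < k.
    rewrite ltn_neqAle (antichain_leq fW A1W' A1a) andbT; apply/negP => /eqP A1k.
    have [y yA fy] := antichain_hits fW A1W' A1a A1k (ltn_ord c).
    have gy : good y by apply/goodP; exists A1.
    have := subsetP A1W y yA; rewrite in_setD in_setU in_set.
    by rewrite (goodW _ gy) fy eqxx (cmax y gy fy) orbT.
  exists A0, (fun z => if z \in K then k.-1 else g z); split=> //.
    exact: fintype.subset_trans A0W W'W.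
  split=> [z zW|y z yW zW]; rewrite -/k.
    case: ifPn => zK; first by rewrite ltn_predL (leq_ltn_trans _ A1k).
    by apply: leq_trans (ltnW A1k); apply: gW.1; rewrite in_setD zK.
  have inW t : t \in W -> t \notin K -> t \in W :\: K.
    by move=> tW tK; rewrite in_setD tK tW.
  have g_lt t : t \in W -> t \notin K -> g t < k.-1.
    move=> tW tK; apply: leq_trans (gW.1 t (inW _ tW tK)) _.
    by rewrite -ltnS (ltn_predK A1k); exact: A1k.
  case: ifPn => yK; case: ifPn => zK e.
  - have Kle t : t \in K -> t != a -> [/\ t \in W :\ a, f t = c & lt t a].
      rewrite in_setU in_set1 in_set => /orP[->//|/and3P[tW /eqP ft tx] _].
      by split=> //; case/orP: tx => [/eqP ->//|/tr]; apply.
    have [ya|/(Kle _ yK)[yW' fy ya]] := eqVneq y a;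
    have [za|/(Kle _ zK)[zW' fz za]] := eqVneq z a.
    + by rewrite ya za eqxx.
    + by rewrite ya za !orbT.
    + by rewrite za ya !orbT.
    + by apply: fW.2 => //; rewrite fy fz.
  - by have := g_lt _ zW zK; rewrite -e ltnn.
  - by have := g_lt _ yW yK; rewrite e ltnn.
  - by apply: gW.2; rewrite ?inW.
(* Otherwise [a] extends the antichain [A] and forms a chain of its own. *)
have aA : a \notin A by apply/negP => /(subsetP AW); rewrite !inE eqxx.
exists (a |: A), (fun z => if z == a then k else f z).
have -> : #|a |: A| = k.+1 by rewrite cardsU1 aA kA.
have inW' t : t \in W -> t != a -> t \in W :\ a by rewrite !inE => -> ->.
split.
- by rewrite subUset sub1set aW (fintype.subset_trans AW W'W).
- move=> y z; rewrite !in_setU !in_set1.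
  move=> /orP[/eqP ->|yA] /orP[/eqP ->|zA].
  + by rewrite irr.
  + by apply: amax; apply: (subsetP (fintype.subset_trans AW W'W)).
  + by case/imsetP: yA => c _ ->; apply: nca.
  + exact: Aa.
split=> [z zW|y z yW zW].
  by case: eqVneq => // za; rewrite ltnS ltnW // fW.1 // inW'.
case: (eqVneq y a) => ya; case: (eqVneq z a) => za e.
- by rewrite ya za eqxx.
- by have := fW.1 z (inW' _ zW za); rewrite -e ltnn.
- by have := fW.1 y (inW' _ yW ya); rewrite e ltnn.
- by apply: fW.2; rewrite ?inW'.
Qed.

(** * Perfection of incomparability graphs *)

Lemma leq_clique_chromatic (G : sgraph) : clique_number G <= chromatic_number G.
Proof.
rewrite /chromatic_number; case: ex_minnP => k /existsP[f fP] _.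
apply/bigmax_leqP => K /forall_inP Kc.
have fi : {in K &, injective f}.
  move=> x y xK yK fxy; apply/eqP; apply: contraTT (forallP (forallP fP x) y) => xy.
  have /forall_inP/(_ y yK)/implyP/(_ xy) exy := Kc x xK.
  by rewrite exy fxy eqxx.
by rewrite -(card_in_imset fi) -[leqRHS]card_ord max_card.
Qed.

Lemma cocomparability_chromatic (G : sgraph) (lt : rel G) :
  irreflexive lt -> transitive lt ->
  (forall x y, x != y -> edge x y = ~~ (lt x y || lt y x)) ->
  chromatic_number G = clique_number G.
Proof.
move=> irr tr eE; apply/eqP; rewrite eqn_leq leq_clique_chromatic andbT.
have [A [f [_ Aa [fk fc]]]] := dilworth [set: G] irr tr.
have cA : clique A.
  apply/forall_inP => x xA; apply/forall_inP => y yA; apply/implyP => xy.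
  by rewrite eE // (negPf (Aa _ _ xA yA)) (negPf (Aa _ _ yA xA)).
have leA : #|A| <= clique_number G.
  exact: (@leq_bigmax_cond _ (@clique G) (fun K : {set G} => #|K|)).
apply: leq_trans leA.
rewrite /chromatic_number; case: ex_minnP => k _; apply.
apply/existsP; exists [ffun x => Ordinal (fk x (in_setT x))].
apply/forallP => x; apply/forallP => y; apply/implyP => xy; rewrite !ffunE.
have nxy : x != y by apply: contraTneq xy => ->; rewrite edge_irrefl.
apply: contraTneq xy => -[] /(fc _ _ (in_setT x) (in_setT y)).
by rewrite (negPf nxy) eE // negbK.
Qed.

Lemma cocomparability_perfect (G : sgraph) (lt : rel G) :
  irreflexive lt -> transitive lt ->
  (forall x y, x != y -> edge x y = ~~ (lt x y || lt y x)) ->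
  perfect G.
Proof.
move=> irr tr eE W.
apply: (@cocomparability_chromatic (induced W) (fun u v => lt (val u) (val v))).
- by move=> u; apply: irr.
- by move=> v u w; apply: tr.
- by move=> u v uv; apply: eE; rewrite val_eqE.
Qed.

(** * The canonical representation *)

Section LengthCone.

Import all_order all_algebra finmap boolp classical_sets lra.
Import Order.TTheory GRing.Theory Num.Theory.
Local Open Scope ring_scope.

Lemma canonical_natural (R : realType) (X : finType) (P : rel X) :
  interval_order R P -> natural_representation R P (canon_l R P) (canon_r R P).
Proof. by case/canonicalP. Qed.

Lemma canon_le (R : realType) (X : finType) (P : rel X) x :
  interval_order R P -> (canon_l R P x <= canon_r R P x)%N.
Proof. by case/canonical_natural => -[/(_ x)]; rewrite ler_nat. Qed.

Lemma canon_prec (R : realType) (X : finType) (P : rel X) x y :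
  interval_order R P -> P x y = (canon_r R P x < canon_l R P y)%N.
Proof.
case/canonical_natural => -[_ /(_ x y) [h1 h2]] _.
by apply/idP/idP => [/h1|]; rewrite ?ltr_nat // => h; apply: h2; rewrite ltr_nat.
Qed.

Lemma canon_r_lt (R : realType) (X : finType) (P : rel X) x :
  interval_order R P -> (canon_r R P x < magnitude P)%N.
Proof.
case/canonicalP => _ e.
have : (range (Defs.canonical R P).1 `|` range (Defs.canonical R P).2)%classic (canon_r R P x).
  by right; exists x.
by rewrite e.
Qed.

(** Every number below the magnitude is both a left and a right endpoint.  A
    down-set only depends on the left endpoint of its interval, so [magnitude P]
    distinct down-sets force [magnitude P] distinct left endpoints; and the
    down-sets of two consecutive left endpoints [k] and [k + 1] can only differ
    by intervals ending at [k]. *)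
Lemma canon_onto (R : realType) (X : finType) (P : rel X) k :
  interval_order R P -> (k < magnitude P)%N ->
  (exists y, canon_l R P y = k) /\ (exists z, canon_r R P z = k).
Proof.
move=> ioP km; set m := magnitude P in km.
pose l := canon_l R P; pose r := canon_r R P.
have lm x : (l x < m)%N := leq_ltn_trans (canon_le x ioP) (canon_r_lt x ioP).
pose E (i : 'I_m) := [set x | (r x < i)%N].
pose Ls := [set i : 'I_m | [exists z, l z == i]].
have imE : [set downset P z | z in [set: X]] \subset E @: Ls.
  apply/fintype.subsetP => _ /imsetP[z _ ->]; apply/imsetP; exists (Ordinal (lm z)).
    by rewrite inE; apply/existsP; exists z.
  by apply/setP => x; rewrite !inE (canon_prec _ _ ioP).
have mE : (m <= #|E @: Ls|)%N by apply: subset_leq_card imE.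
have LsT : #|Ls| = m.
  apply/eqP; rewrite eqn_leq (leq_trans mE (leq_imset_card _ _)) andbT.
  by rewrite -[leqRHS]card_ord max_card.
have onto i : (i < m)%N -> exists y, l y = i.
  move=> im; have : Ordinal im \in Ls.
    suff /eqP -> : Ls == [set: 'I_m] by rewrite finset.in_setT.
    by rewrite eqEcard finset.subsetT cardsT card_ord LsT leqnn.
  by rewrite inE => /existsP[y /eqP]; exists y.
have LsE i : i \in Ls by rewrite inE; have [y <-] := onto i (ltn_ord i); apply/existsP; exists y.
split; first exact: onto.
have Einj : {in Ls &, injective E}.
  by apply/imset_injP; rewrite eqn_leq leq_imset_card LsT.
(* The last number [magnitude P - 1] ends every interval that it starts. *)
have [k1m|mk1] := ltnP k.+1 m; last first.
  have [y ly] := onto k km; exists y.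
  have := canon_le y ioP; have := canon_r_lt y ioP.
  by rewrite -/(l y) ly -/m; lia.
have /eqP nE : E (Ordinal km) <> E (Ordinal k1m).
  by move=> /Einj - /(_ (LsE _) (LsE _)) /(congr1 val) /=; lia.
have /subsetPn[z] : ~~ (E (Ordinal k1m) \subset E (Ordinal km)).
  apply: contra nE => s; rewrite finset.eqEsubset s andbT.
  by apply/fintype.subsetP => x; rewrite !inE /=; lia.
by rewrite !inE /= => z1 z2; exists z; rewrite -/(r z); lia.
Qed.

(** * The length cone *)

(** Canonical lengths are minimal: between the endpoints of [x] there is a
    sequence of intervals, alternately ending and starting at consecutive
    integers, that forces any representation to leave as much space. *)
Lemma canon_lengths_le (R : realType) (X : finType) (P : rel X) (l r : X -> R) x :
  interval_order R P -> interval_representation P l r ->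
  (canon_r R P x)%:R - (canon_l R P x)%:R <= r x - l x.
Proof.
move=> ioP [[_ mod] sep].
have incomp y z : (canon_l R P y <= canon_r R P z)%N -> l y <= r z.
  rewrite leNgt => yz; apply/negP => /mod; rewrite (canon_prec _ _ ioP); lia.
have step d y : (canon_l R P x + d < magnitude P)%N ->
    canon_r R P y = (canon_l R P x + d)%N -> l x + d%:R <= r y.
  elim: d y => [|d IH] y dm ry.
    by rewrite addr0; apply: incomp; rewrite ry addn0.
  have dm' : (canon_l R P x + d < magnitude P)%N by lia.
  have [_ [z rz]] := canon_onto ioP dm'.
  have [[w lw] _] := canon_onto ioP dm.
  have h1 := IH z dm' rz.
  have h2 : r z + 1 <= l w by apply: sep; rewrite (canon_prec _ _ ioP); lia.
  have h3 : l w <= r y by apply: incomp; rewrite ry lw.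
  by rewrite -natr1; lra.
have xle := canon_le x ioP.
have := step (canon_r R P x - canon_l R P x)%N x.
rewrite subnKC // => /(_ (canon_r_lt x ioP) erefl).
by rewrite natrB //; lra.
Qed.

Lemma length_cone_ge0 (R : realType) n (P : rel 'I_n) v x :
  interval_order R P -> length_cone P v -> 0 <= v 0 x :> R.
Proof.
move=> ioP [_ [l [r [rep ->]]] <-]; rewrite !mxE subr_ge0.
exact: canon_lengths_le.
Qed.

Lemma extender_in_cone (R : realType) n (P : rel 'I_n) (S : {set 'I_n}) :
  interval_order R P -> fundamental_extender R P S ->
  length_cone P (char_vector R S).
Proof.
move=> ioP [_ [i [Z [im ZLR ->]]]].
pose l := canon_l R P; pose r := canon_r R P.
have lr x : (l x <= r x)%N by apply: canon_le.
have rm x : (r x < magnitude P)%N by apply: canon_r_lt.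
(* All endpoints from [i] on move right by 1, except that left endpoints of
   intervals in [Z] stay at [i]; moreover the right endpoints [i - 1] of
   intervals in [Z] move to [i]. *)
pose l' x := (l x + ((i <= l x) && (x \notin Z)))%N.
pose r' x := (r x + ((i <= r x) || (x \in Z)))%N.
have prec x y : P x y = (r' x < l' y)%N.
  rewrite (canon_prec _ _ ioP) -/(r x) -/(l y) /r' /l'.
  have hx := lr x; have hy := lr y.
  have sx (b : bool) (m : nat) : (b -> m == i) -> b ==> (m == i).
    by case: b => // ->.
  by case: ZLR => /fintype.subsetP s; move: (s x) (s y);
    rewrite !inE -/(r x) -/(r y) -/(l x) -/(l y) => /sx + /sx;
    case: (x \in Z); case: (y \in Z) => /=; lia.
have le' x : (l' x <= r' x)%N.
  by rewrite /l' /r'; have := lr x; case: (x \in Z); lia.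
exists (\row_x ((r' x)%:R - (l' x)%:R)).
  exists (fun x => (l' x)%:R), (fun x => (r' x)%:R); split=> //; split; last first.
    by move=> x y; rewrite prec natr1 ler_nat.
  by split=> [x|x y]; rewrite ?ler_nat ?ltr_nat ?prec.
apply/rowP => x; rewrite !mxE -/(l x) -/(r x) !natrD.
suff -> : (x \in gap_set R P i :|: Z) =
    (((i <= r x) || (x \in Z)) - ((i <= l x) && (x \notin Z)))%N :> nat.
  rewrite natrB; first by lra.
  by have := lr x; case: (x \in Z); lia.
rewrite !inE -/(l x) -/(r x); have := lr x; have := rm x.
have : x \in Z -> (r x).+1 = i \/ l x = i.
  by case: ZLR => /fintype.subsetP s /s; rewrite inE => /eqP; auto.
case: (x \in Z) => [/(_ isT)|_]; lia.
Qed.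

Lemma char_vector_integral (R : realType) n (S : {set 'I_n}) :
  integral_vector (char_vector R S).
Proof. by move=> x; rewrite mxE natr_int. Qed.

(** A Hilbert set is not the disjoint union of two fundamental extenders. *)
Lemma hilbert_set_indecomposable (R : realType) n (P : rel 'I_n)
    (S S1 S2 : {set 'I_n}) :
  interval_order R P -> hilbert_set R P S ->
  fundamental_extender R P S1 -> fundamental_extender R P S2 ->
  S1 :&: S2 = finset.set0 -> S = S1 :|: S2 -> False.
Proof.
move=> ioP [_ [B [[[Bcone Bgen] Bmin] SB]]] E1 E2 dis eS.
have chiS : char_vector R S = char_vector R S1 + char_vector R S2.
  apply/rowP => x; rewrite !mxE eS finset.in_setU -natrD.
  by have /setP/(_ x) := dis; rewrite !inE; case: (_ \in S1); case: (_ \in S2).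
have cone_basis b x : b \in B -> 0 <= b 0 x.
  by move=> /Bcone[_ /length_cone_ge0]; apply.
(* The disjoint set [T'] provides a coordinate where the characteristic vector
   of [T] vanishes but that of [S] does not. *)
have gen T T' c : T' != finset.set0 -> T :&: T' = finset.set0 -> T' \subset S ->
    char_vector R T = \sum_(b <- B) b *+ c b -> c (char_vector R S) = 0%N.
  move=> /set0Pn[x xT'] dT sT' /rowP/(_ x).
  have xS := fintype.subsetP sT' _ xT'.
  have /negPf xT : x \notin T.
    by apply/negP => xT; have /setP/(_ x) := dT; rewrite !inE xT xT'.
  rewrite (big_fsetD1 (char_vector R S)) //= !mxE xT summxE => e.
  have rest0 : 0 <= \sum_(b <- (B `\ char_vector R S)%fset) (b *+ c b) 0 x.
    rewrite big_seq; apply: sumr_ge0 => b; rewrite in_fsetD1 => /andP[_ bB].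
    by rewrite mulmxnE mulrn_wge0 // cone_basis.
  move: e; rewrite mulmxnE mxE xS => e.
  have : (c (char_vector R S))%:R <= 0 :> R by rewrite [leRHS]e lerDl.
  by rewrite (_ : 0 = 0%:R) // ler_nat leqn0 => /eqP.
have [c1 e1] := Bgen _ (extender_in_cone ioP E1) (char_vector_integral _ _).
have [c2 e2] := Bgen _ (extender_in_cone ioP E2) (char_vector_integral _ _).
have c10 : c1 (char_vector R S) = 0%N.
  by apply: (gen S1 S2 c1 _ dis _ e1); [case: E2|rewrite eS finset.subsetUr].
have c20 : c2 (char_vector R S) = 0%N.
  by apply: (gen S2 S1 c2 _ _ _ e2); [case: E1|rewrite finset.setIC|rewrite eS finset.subsetUl].
have HB' : hilbert_basis (length_cone P) (B `\ char_vector R S)%fset.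
  split=> [b|v Cv iv]; first by rewrite in_fsetD1 => /andP[_ /Bcone].
  have [c ->] := Bgen v Cv iv.
  exists (fun b => c b + (c1 b + c2 b) * c (char_vector R S))%N.
  rewrite (big_fsetD1 (char_vector R S)) //= {1}chiS e1 e2.
  rewrite !(big_fsetD1 (char_vector R S) SB) /= c10 c20 !mulr0n !add0r.
  rewrite -big_split /= -sumrMnl addrC -big_split /=; apply: eq_bigr => b _.
  by rewrite mulrnDr mulrnA mulrnDr.
have /fsetP/(_ (char_vector R S)) := Bmin _ HB' (fsubD1set _ _).
by rewrite SB in_fsetD1 eqxx.
Qed.

End LengthCone.

(** * Indices of fundamental extenders *)

(** [S] is the [i]th gap set together with a set of intervals that all end just
    before that gap or all start just after it; [S] may be empty. *)
Definition extender_at (R : realType) (X : finType) (P : rel X) (i : nat)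
    (S : {set X}) : Prop :=
  exists Z : {set X},
    [/\ i <= magnitude P,
        Z \subset left_borderline R P i \/ Z \subset right_borderline R P i
      & S = gap_set R P i :|: Z].

Lemma extender_at_setD1 (R : realType) (X : finType) (P : rel X) i
    (S : {set X}) x :
  extender_at R P i S -> x \notin gap_set R P i -> S :\ x != set0 ->
  fundamental_extender R P (S :\ x).
Proof.
move=> [Z [im ZLR ->]] xG S0; split=> //; exists i, (Z :\ x); split=> //.
  by case: ZLR => s; [left|right]; apply: fintype.subset_trans s; apply: subD1set.
rewrite setDUl; congr (_ :|: _); apply/setP => y; rewrite !inE andbC.
by case: eqVneq => [->|]; rewrite ?andbT // andbF; apply/esym/negbTE; rewrite inE in xG.
Qed.

(** A borderline element of a Hilbert set can be split off, so if it is an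
    extender by itself, then nothing else is in the set. *)
Lemma hilbert_set_singleton (R : realType) n (P : rel 'I_n) i
    (S : {set 'I_n}) x :
  interval_order R P -> hilbert_set R P S -> extender_at R P i S ->
  x \in S -> x \notin gap_set R P i -> fundamental_extender R P [set x] ->
  S = [set x].
Proof.
move=> ioP hS eS xS xG ex; apply: boolp.contrapT => /eqP nSx.
have D0 : S :\ x != set0.
  by apply: contraNneq nSx => D0; rewrite -(setD1K xS) D0 setU0.
apply: (hilbert_set_indecomposable ioP hS ex (extender_at_setD1 eS xG D0)).
  by apply/setP => y; rewrite !inE; case: eqVneq.
by rewrite setD1K.
Qed.

Lemma extender_at_le (R : realType) (X : finType) (P : rel X) i (S : {set X}) x :
  interval_order R P -> extender_at R P i S -> x \in S ->
  canon_l R P x <= i <= (canon_r R P x).+1.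
Proof.
move=> ioP [Z [_ ZLR ->]]; have := canon_le x ioP.
rewrite in_setU => xlr /orP[|xZ]; first by rewrite inE; lia.
by case: ZLR => /subsetP/(_ x xZ); rewrite inE; lia.
Qed.

Lemma in_gap_set (R : realType) (X : finType) (P : rel X) i x :
  interval_order R P ->
  (x \in gap_set R P i) = (canon_l R P x < i <= canon_r R P x).
Proof. by move=> ioP; rewrite inE; have := canon_r_lt x ioP; lia. Qed.

Lemma gap_set_sub (R : realType) (X : finType) (P : rel X) i (S : {set X}) :
  extender_at R P i S -> gap_set R P i \subset S.
Proof. by case=> Z [_ _ ->]; apply: subsetUl. Qed.

(** Two disjoint extenders of the same index have an empty gap set in common, and
    then every single borderline element is an extender. *)
Lemma disjoint_same_index (R : realType) n (P : rel 'I_n) i (S T : {set 'I_n}) :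
  interval_order R P -> hilbert_set R P S ->
  extender_at R P i S -> extender_at R P i T -> S :&: T = set0 ->
  exists2 x, S = [set x] & x \notin gap_set R P i.
Proof.
move=> ioP hS eS eT dST.
have G0 : gap_set R P i = set0.
  by apply/eqP; rewrite -subset0 -dST subsetI !gap_set_sub.
have /set0Pn[x xS] := hS.1.1.
exists x; last by rewrite G0 inE.
apply: (hilbert_set_singleton ioP hS eS xS); first by rewrite G0 inE.
split; first by apply/set0Pn; exists x; rewrite inE.
case: eS xS => Z [im ZLR ->]; rewrite G0 set0U => xZ.
exists i, [set x]; split; rewrite ?G0 ?set0U //.
by case: ZLR => /subsetP/(_ x xZ); rewrite !sub1set; [left|right].
Qed.

(** * The order on the Hilbert sets *)

Theorem theorem6p6 (R : realType) (n : nat) (P : rel 'I_n) :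
  interval_order R P -> perfect (hilbert_extender_graph R P).
Proof.
move=> ioP.
pose l := canon_l R P; pose r := canon_r R P.
have hV (v : hilbert_vertex R P) : hilbert_set R P (val v).
  exact: boolp.asboolW (valP v).
have /boolp.choice[idx idxP] : forall v : hilbert_vertex R P,
    exists i, extender_at R P i (val v).
  by move=> v; have [[_ [i [Z eZ]]] _] := hV v; exists i, Z.
pose wt (v : hilbert_vertex R P) := \sum_(x in val v) (l x + r x).
pose rk (v : hilbert_vertex R P) : nat := enum_rank v.
pose key_lt u v := (idx u < idx v) || (idx u == idx v) &&
  ((wt u < wt v) || (wt u == wt v) && (rk u < rk v)).
have key_irr : irreflexive key_lt by move=> u; rewrite /key_lt; lia.
have key_tr : transitive key_lt by move=> v u w; rewrite /key_lt; lia.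
have key_total u v : u != v -> key_lt u v || key_lt v u.
  move=> uv; have : rk u != rk v.
    by apply: contraNneq uv => /val_inj/enum_rank_inj ->.
  by rewrite /key_lt; lia.
pose lt u v := (val u :&: val v == set0) && key_lt u v.
apply: (@cocomparability_perfect (hilbert_extender_graph R P) lt).
- by move=> u; rewrite /lt key_irr andbF.
- move=> v u w /andP[/eqP duv kuv] /andP[/eqP dvw kvw].
  have kuw := key_tr _ _ _ kuv kvw.
  rewrite /lt kuw andbT -[_ == _]negbK; apply/negP => /set0Pn[x /setIP[xu xw]].
  have nuw : val u <> val w by move=> /val_inj e; rewrite e key_irr in kuw.
  have notin y (s t : hilbert_vertex R P) :
      val s :&: val t = set0 -> y \in val s -> y \in val t -> False.
    by move=> /setP/(_ y); rewrite !inE => e ys yt; rewrite ys yt in e.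
  have gap y (t : hilbert_vertex R P) : l y < idx t <= r y -> y \in val t.
    by move=> h; apply: (subsetP (gap_set_sub (idxP t))); rewrite in_gap_set.
  (* A singleton Hilbert set inside a larger Hilbert set consists of an interval
     of the gap set of the latter, never of a borderline interval. *)
  have inner y (s t : hilbert_vertex R P) :
      val s = [set y] -> val t <> val s -> y \in val t -> l y < idx t <= r y.
    move=> e nts yt; apply: boolp.contrapT => /negP h; apply: nts; rewrite e.
    apply: (hilbert_set_singleton ioP (hV t) (idxP t) yt).
      by rewrite in_gap_set.
    by have [] := hV s; rewrite e.
  have wt1 y s : val s = [set y] -> wt s = l y + r y.
    by move=> e; rewrite /wt e big_set1.
  have xlu := extender_at_le ioP (idxP u) xu.
  have xlw := extender_at_le ioP (idxP w) xw.
  rewrite -/(l x) -/(r x) in xlu xlw.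
  have [iuv|iuv|iuv] := ltngtP (idx u) (idx v); last 1 first.
  + have eu := idxP u; rewrite iuv in eu.
    have [a ea aG] := disjoint_same_index ioP (hV u) eu (idxP v) duv.
    rewrite setIC in duv.
    have [b eb bG] := disjoint_same_index ioP (hV v) (idxP v) eu duv.
    have xa : x = a by apply/set1P; rewrite -ea.
    subst a.
    have [ivw|ivw|ivw] := ltngtP (idx v) (idx w).
    * (* [val u = [set x]] and [val v = [set b]], with the same empty gap set.
         As [x] starts just after that gap, the sum in the key forces [b] to
         start there too and to end no earlier than [x], hence to span the gap
         of [w]. *)
      have xgw := inner _ _ _ ea (nesym nuw) xw.
      have blv := extender_at_le ioP (idxP v) (_ : b \in val v).
      rewrite eb set11 in blv; have {}blv := blv isT.
      apply: (notin b _ _ dvw); first by rewrite eb set11.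
      apply: gap; move: kuv; rewrite /key_lt (wt1 _ _ ea) (wt1 _ _ eb).
      move: aG bG; rewrite !in_gap_set // -/(l x) -/(r x) -/(l b) -/(r b).
      rewrite -/(l b) -/(r b) in blv; lia.
    * by move: kvw; rewrite /key_lt; lia.
    * have ew := idxP w; rewrite -ivw in ew; rewrite setIC in dvw.
      have [c ec _] := disjoint_same_index ioP (hV w) ew (idxP v) dvw.
      by apply: nuw; rewrite ea ec; congr [set _]; apply/set1P; rewrite -ec.
  + have [ivw|ivw|ivw] := ltngtP (idx v) (idx w).
    * (* [x] spans the gap of [v]. *)
      by apply: (notin x _ _ duv xu); apply: gap; lia.
    * by move: kvw; rewrite /key_lt; lia.
    * (* Mirror image: [val v = [set b]] and [val w = [set x]], where [b] and [x]
         end just before the common empty gap and [b] starts no later than [x],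
         hence spans the gap of [u]. *)
      have ew := idxP w; rewrite -ivw in ew.
      have [b eb bG] := disjoint_same_index ioP (hV v) (idxP v) ew dvw.
      rewrite setIC in dvw.
      have [c ec cG] := disjoint_same_index ioP (hV w) ew (idxP v) dvw.
      have xc : x = c by apply/set1P; rewrite -ec.
      subst c.
      have xgu := inner _ _ _ ec nuw xu.
      have blv := extender_at_le ioP (idxP v) (_ : b \in val v).
      rewrite eb set11 in blv; have {}blv := blv isT.
      apply: (notin b _ _ duv); last by rewrite eb set11.
      apply: gap; move: kvw; rewrite /key_lt (wt1 _ _ ec) (wt1 _ _ eb).
      move: cG bG; rewrite !in_gap_set // -/(l x) -/(r x) -/(l b) -/(r b).
      rewrite -/(l b) -/(r b) in blv; lia.
  + by move: kuv; rewrite /key_lt; lia.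
- move=> u v uv; rewrite /= /hilbert_edge uv /= /lt [val v :&: _]setIC.
  by rewrite -andb_orr key_total // andbT.
Qed.
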